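(* Let $(G,B,m,w)$ be a connected weighted finite graph with boundary, with nonempty interior $\Omega$, such that $E(B,B)=\emptyset$ (no edge joins two boundary vertices). Then $$\nu_i+\lambda_{\min}(A_B\operatorname{Deg}^{-1}A_\Omega)\le\lambda_i\le\nu_i+\lambda_{\max}(A_B\operatorname{Deg}^{-1}A_\Omega)$$ for any $i=1,2,\dots,|\Omega|$. Moreover, the equalities hold for all $i=1,2,\dots,|\Omega|$ if and only if (1) every boundary vertex is adjacent to only one interior vertex, and (2) the weighted degree $\operatorname{Deg}_B(x)$ relative to $B$ is independent of $x\in\Omega$.
   Context: A weighted finite graph $(G,m,w)$ is a finite simple graph $G$ with vertex set $V$ and edge set $E$, a vertex-measure $m:V\to(0,\infty)$ and an edge-weight $w:E\to(0,\infty)$; $w$ is extended to a symmetric function on $V\times V$ by $w_{xy}=0$ when $\{x,y\}\notin E$. A weighted finite graph with boundary $(G,B,m,w)$ is a weighted finite graph with a nonempty subset $B\subset V$ (the boundary); $\Omega=V\setminus B$ is the interior. $\mathbb{R}^S$ is the space of real functions on $S$, with inner product $\langle u,v\rangle_S=\sum_{x\in S}u(x)v(x)m_x$. $\operatorname{Deg}(x)=\frac1{m_x}\sum_{y\in V}w_{xy}$ for $x\in V$, and $\operatorname{Deg}_B(x)=\frac1{m_x}\sum_{y\in B}w_{xy}$ for $x\in\Omega$. Laplacian: $\Delta u(x)=\frac1{m_x}\sum_{y\in V}(u(x)-u(y))w_{xy}$ for $u\in\mathbb{R}^V$. Dirichlet Laplacian: for $u\in\mathbb{R}^\Omega$ let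 $E_0(u)\in\mathbb{R}^V$ be its extension by $0$ on $B$, and $\Delta^Du=(\Delta E_0(u))|_\Omega$, a nonnegative self-adjoint operator on $\mathbb{R}^\Omega$ with eigenvalues (Dirichlet eigenvalues), counted with multiplicity, $0\le\lambda_1\le\dots\le\lambda_{|\Omega|}$. Neumann Laplacian: for $u\in\mathbb{R}^\Omega$, let $N_0(u)\in\mathbb{R}^V$ be the unique function with $N_0(u)=u$ on $\Omega$ and $\Delta N_0(u)=0$ on $B$. Set $\Delta^N u=(\Delta N_0(u))|_\Omega$, a nonnegative self-adjoint operator on $\mathbb{R}^\Omega$ with eigenvalues (Neumann eigenvalues), counted with multiplicity, $0\le\nu_1\le\dots\le\nu_{|\Omega|}$. Weighted adjacency operators: $A_B:\mathbb{R}^B\to\mathbb{R}^\Omega$, $A_Bu(x)=\frac1{m_x}\sum_{y\in B}u(y)w_{xy}$ for $x\in\Omega$, and $A_\Omega:\mathbb{R}^\Omega\to\mathbb{R}^B$, $A_\Omega u(x)=\frac1{m_x}\sum_{y\in\Omega}u(y)w_{xy}$ for $x\in B$. In $A_B\operatorname{Deg}^{-1}A_\Omega:\mathbb{R}^\Omega\to\mathbb{R}^\Omega$, $\operatorname{Deg}^{-1}$ denotes multiplication by the function $1/\operatorname{Deg}$ on $B$; this composite is self-adjoint. $\lambda_{\min}(T)$ and $\lambda_{\max}(T)$ are the minimal and maximal eigenvalues of $T$. *)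

(* Defs.v *)
From HB Require Import structures.
From mathcomp Require Import all_boot all_order all_algebra.
From mathcomp Require Import boolp classical_sets reals.

Set Implicit Arguments.
Unset Strict Implicit.
Unset Printing Implicit Defensive.

Import Order.TTheory GRing.Theory Num.Theory passmx.
Local Open Scope ring_scope.

Section Spectrum.
Variables (R : realType) (U : vectType R).
Implicit Type f : U -> U.

(* The operators below are plain functions; [linfun] bundles them as elements
   of ['End(U)] and is meaningful only for linear [f].  Multiplicity is the dimension of the eigenspace. *)
Definition mult f (a : R) : nat := \dim (leigenspace (linfun f) a).

Definition is_spectrum f (s : seq R) : Prop :=
  sorted <=%R s /\ forall a, count_mem a s = mult f a.

(* Nondecreasing list of the real eigenvalues, repeated by multiplicity. It has
   [\dim {:U}] entries exactly when [f] is diagonalizable. *)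
Definition spectrum f : seq R := xget [::] [set s | is_spectrum f s]%classic.

(* 0-based: [eigval f i] is the (i+1)-st smallest eigenvalue. *)
Definition eigval f (i : nat) : R := (spectrum f)`_i.

Definition eigval_min f : R := head 0 (spectrum f).
Definition eigval_max f : R := last 0 (spectrum f).

Lemma poly_roots_finite (p : {poly R}) :
  p != 0 -> exists s : seq R, forall x, root p x -> x \in s.
Proof.
have [n] := ubnP (size p); elim: n p => // n IH p lepn p0.
case: (EM (exists x, root p x)) => [[x px]|np]; last first.
  by exists [::] => x px; case: np; exists x.
have /factor_theorem[q pE] := px.
have q0 : q != 0 by apply: contraNneq p0 => q0; rewrite pE q0 mul0r.
have [|//|s sP] := IH q.
  by move: lepn; rewrite pE size_Mmonic ?monicXsubC// size_XsubC addn2.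
exists (x :: s) => y; rewrite pE rootM root_XsubC inE.
by case/orP => [/sP ->|->]; rewrite ?orbT.
Qed.

Lemma leigenvalue_finite (g : 'End(U)) :
  exists s : seq R, forall a, leigenvalue g a -> a \in s.
Proof.
have eP := vbasisP {:U}%VS.
pose M := mxof (vbasis {:U}) (vbasis {:U}) g.
have [|s sP] := @poly_roots_finite (char_poly M).
  exact/monic_neq0/char_poly_monic.
exists s => a ga; apply: sP; rewrite -eigenvalue_root_char.
apply: contraNneq ga => M0.
rewrite (leigenspaceE eP).
by rewrite M0; apply/eqP; rewrite vsof0.
Qed.

Lemma spectrumP f : is_spectrum f (spectrum f).
Proof.
apply: (@xgetPex _ [::] [set s | is_spectrum f s]%classic).
have [s sP] := leigenvalue_finite (linfun f).
pose t := flatten [seq nseq (mult f a) a | a <- undup s].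
have tP a : count_mem a t = mult f a.
  rewrite count_flatten -map_comp sumnE big_map.
  rewrite (eq_bigr (fun b => (b == a) * mult f b)%N); last first.
    by move=> b _; rewrite /= count_nseq.
  case: (boolP (a \in undup s)) => [sa|].
    rewrite (bigD1_seq a)//= ?undup_uniq// eqxx mul1n big1 ?addn0//.
    by move=> b /negbTE ->.
  rewrite mem_undup => sa; have /eqP m0 : mult f a == 0.
    rewrite /mult dimv_eq0; apply: contraNT sa => ?; exact: sP.
  rewrite m0 big1// => b _; case: eqP => [->|]; by rewrite ?m0.
exists (sort <=%R t); split; first exact/sort_sorted/le_total.
by move=> a; rewrite -tP; apply/permP; rewrite perm_sort.
Qed.

Lemma is_spectrum_uniq f s t : is_spectrum f s -> is_spectrum f t -> s = t.
Proof.
move=> [sS sP] [tS tP]; apply: (sorted_eq le_trans le_anti) => //.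
by apply/allP => x _ /=; rewrite sP tP.
Qed.

End Spectrum.

Record wgraph (R : realType) (V : finType) := WGraph {
  edge : rel V;
  edge_sym : symmetric edge;
  edge_irr : irreflexive edge;
  meas : V -> R;
  meas_gt0 : forall x, 0 < meas x;
  wt : V -> V -> R;
  wt_sym : forall x y, wt x y = wt y x;
  wt_gt0 : forall x y, edge x y -> 0 < wt x y;
  wt_eq0 : forall x y, ~~ edge x y -> wt x y = 0;
  bd : {set V};
  bd_neq0 : bd != finset.set0
}.

Section Operators.
Variables (R : realType) (V : finType) (G : wgraph R V).

Definition connected : Prop := forall x y, connect (edge G) x y.

Definition bd_vertex := {x : V | x \in bd G}.
Definition int_vertex := {x : V | x \notin bd G}.

Implicit Types (u : {ffun int_vertex -> R^o}) (v : {ffun V -> R^o}).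

Definition Deg (x : V) : R := (meas G x)^-1 * \sum_y wt G x y.

Definition Deg_bd (x : int_vertex) : R :=
  (meas G (val x))^-1 * \sum_(y in bd G) wt G (val x) y.

Definition Lap v : {ffun V -> R^o} :=
  [ffun x => (meas G x)^-1 * \sum_y (v x - v y) * wt G x y].

Definition restr v : {ffun int_vertex -> R^o} := [ffun x => v (val x)].

Definition ext0 u : {ffun V -> R^o} :=
  [ffun x => if insub x is Some x' then u x' else 0].

Definition LapD u := restr (Lap (ext0 u)).

Definition is_extN u v : Prop :=
  (forall x : int_vertex, v (val x) = u x) /\
  (forall y, y \in bd G -> Lap v y = 0).

(* Existence and uniqueness, for connected [G] with nonempty interior, are
   [extNP] and [extN_uniq] below. *)
Definition extN u : {ffun V -> R^o} := xget 0 [set v | is_extN u v]%classic.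

Definition LapN u := restr (Lap (extN u)).

Definition adj_bd (g : {ffun bd_vertex -> R^o}) : {ffun int_vertex -> R^o} :=
  [ffun x => (meas G (val x))^-1 * \sum_y g y * wt G (val x) (val y)].

Definition adj_int u : {ffun bd_vertex -> R^o} :=
  [ffun x => (meas G (val x))^-1 * \sum_y u y * wt G (val x) (val y)].

Definition mul_invDeg (g : {ffun bd_vertex -> R^o}) : {ffun bd_vertex -> R^o} :=
  [ffun x => (Deg (val x))^-1 * g x].

Definition adj_comp u := adj_bd (mul_invDeg (adj_int u)).

Definition no_bd_edge : Prop :=
  forall x y, x \in bd G -> y \in bd G -> ~~ edge G x y.

Lemma Lap_is_linear : linear Lap.
Proof.
move=> a v v'; apply/ffunP => x; rewrite !ffunE.
rewrite scalerAr -mulrDr; congr (_ * _).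
rewrite scaler_sumr -big_split; apply: eq_bigr => y _ /=.
rewrite !ffunE /GRing.scale /= opprD addrACA -mulrBr mulrDl mulrA //.
Qed.

Lemma ext0_is_linear : linear ext0.
Proof.
move=> a v v'; apply/ffunP => x; rewrite !ffunE.
by case: insub => [y|]; rewrite ?ffunE// scaler0 addr0.
Qed.

Lemma restr_is_linear : linear restr.
Proof. by move=> a v v'; apply/ffunP => x; rewrite !ffunE. Qed.

Lemma Lap_energy v :
  (\sum_x meas G x * (v x * Lap v x)) *+ 2 =
  \sum_x \sum_y (v x - v y) ^+ 2 * wt G x y.
Proof.
have H : \sum_x meas G x * (v x * Lap v x) =
         \sum_x \sum_y v x * (v x - v y) * wt G x y.
  apply: eq_bigr => x _; rewrite ffunE [v x * _]mulrCA mulVKf ?lt0r_neq0 ?meas_gt0//.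
  rewrite mulr_sumr.
  by apply: eq_bigr => y _; rewrite mulrA.
rewrite mulr2n {1}H H [X in _ + X]exchange_big -big_split.
apply: eq_bigr => x _; rewrite -big_split; apply: eq_bigr => y _ /=.
rewrite (wt_sym G y x) -mulrDl; congr (_ * _).
by rewrite -[v y - v x]opprB mulrN -mulrBl expr2.
Qed.

Hypothesis Gconn : connected.
Hypothesis int_neq0 : ~: bd G != finset.set0.

Lemma extN_ker v : is_extN 0 v -> v = 0.
Proof.
move=> [v0 Lv0].
have vint x : x \notin bd G -> v x = 0.
  by move=> xB; have := v0 (exist _ x xB); rewrite ffunE.
have E0 : \sum_x \sum_y (v x - v y) ^+ 2 * wt G x y = 0.
  rewrite -Lap_energy big1 ?mul0rn// => x _.
  have [xB|xB] := boolP (x \in bd G); first by rewrite Lv0// mulr0 mulr0 ?mul0rn.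
  by rewrite vint// mul0r mulr0 ?mul0rn.
have w_ge0 x y : 0 <= wt G x y.
  by have [/wt_gt0/ltW//|/wt_eq0->] := boolP (edge G x y).
have t_ge0 x y : 0 <= (v x - v y) ^+ 2 * wt G x y.
  by rewrite mulr_ge0 ?sqr_ge0.
have eqv x y : edge G x y -> v x = v y.
  move=> xy; move/eqP: E0; rewrite psumr_eq0; last by move=> z _; apply: sumr_ge0.
  move=> /allP /(_ x (mem_index_enum x)) /=.
  rewrite psumr_eq0// => /allP /(_ y (mem_index_enum y)) /=.
  by rewrite mulf_eq0 sqrf_eq0 subr_eq0 (gt_eqF (wt_gt0 xy)) orbF => /eqP.
have /set0Pn[z] := int_neq0; rewrite inE => zB.
apply/ffunP => x; rewrite ffunE -(vint z zB).
have /connectP[p pth ->] := Gconn x z.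
by elim: p x pth => //= y p IH x /andP[/eqv -> /IH].
Qed.

Lemma extN_uniq u v v' : is_extN u v -> is_extN u v' -> v = v'.
Proof.
move=> [v1 v2] [w1 w2]; apply/eqP; rewrite -subr_eq0; apply/eqP/extN_ker.
have -> : v - v' = -1 *: v' + v by rewrite scaleN1r addrC.
split=> [x|y yB]; first by rewrite !ffunE v1 w1 scaleN1r addNr.
by rewrite Lap_is_linear !ffunE; move: (v2 y yB) (w2 y yB);
  rewrite !ffunE => -> ->; rewrite scaler0 addr0.
Qed.

Let F v : {ffun V -> R^o} := [ffun x => if x \in bd G then Lap v x else v x].

Let F_is_linear : linear F.
Proof.
move=> a v v'; apply/ffunP => x.
rewrite [LHS]ffunE [RHS]ffunE [(a *: F v) x]ffunE [F v x]ffunE [F v' x]ffunE.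
case: ifP => _; last by rewrite !ffunE.
by rewrite Lap_is_linear ffunE [(a *: Lap v) x]ffunE.
Qed.

Lemma extNP u : is_extN u (extN u).
Proof.
apply: (@xgetPex _ 0 [set v | is_extN u v]%classic).
pose Fl := GRing.isLinear.Build R {ffun V -> R^o} {ffun V -> R^o} _ F F_is_linear.
pose FL : {linear {ffun V -> R^o} -> {ffun V -> R^o}} := HB.pack F Fl.
have FE v : linfun FL v = F v by rewrite lfunE.
have inj : lker (linfun FL) == 0%VS.
  rewrite -subv0; apply/subvP => v; rewrite memv_ker memv0 FE => /eqP F0.
  apply/eqP/extN_ker; split => [x|y yB].
    by move/ffunP: F0 => /(_ (val x)); rewrite !ffunE (negbTE (valP x)).
  by move/ffunP: F0 => /(_ y); rewrite [F v y]ffunE yB [RHS]ffunE.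
exists ((linfun FL)^-1%VF (ext0 u)).
have := lker0_lfunVK inj (ext0 u); set v := (X in linfun FL X).
rewrite FE => /ffunP FvE; split => [x|y yB].
  by have := FvE (val x); rewrite !ffunE (negbTE (valP x)) valK.
have := FvE y; rewrite [LHS]ffunE yB => ->.
by rewrite ffunE insubF// yB.
Qed.

End Operators.

Arguments Deg {R V} G x.
Arguments Deg_bd {R V} G x.
Arguments Lap {R V} G v.
Arguments restr {R V} G v.
Arguments ext0 {R V} G u.
Arguments LapD {R V} G u.
Arguments is_extN {R V} G u v.
Arguments extN {R V} G u.
Arguments LapN {R V} G u.
Arguments adj_bd {R V} G g.
Arguments adj_int {R V} G u.
Arguments mul_invDeg {R V} G g.
Arguments adj_comp {R V} G u.

(* Main.v *)
(* Without edges inside [B], the harmonic extension of [u] to [B] is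
   [Deg^-1 A_Omega u], whence [Delta^D = Delta^N + A_B Deg^-1 A_Omega].  All three
   operators are self-adjoint for the weighted inner product, so the inequalities are
   Weyl's.  Equality everywhere forces [lambda_min = lambda_max] for the last operator
   (and conversely), i.e. that it is a scalar [c].  Its matrix has nonnegative terms:
   the off-diagonal entries vanish iff no boundary vertex has two interior neighbours,
   and then its diagonal is [Deg_B]. *)
From HB Require Import structures.
Require Import Defs.
From mathcomp Require Import all_boot all_order all_algebra.
From mathcomp Require Import reals complex.
From mathcomp Require Import ring lra.

Set Implicit Arguments.
Unset Strict Implicit.
Unset Printing Implicit Defensive.

Import Order.TTheory GRing.Theory Num.Theory passmx.
Local Open Scope ring_scope.

(** * Spectral theory on a finite-dimensional real inner product space *)

Section InnerProduct.
Variables (R : realType) (U : vectType R) (ip : U -> U -> R).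
Hypothesis ipC : forall u v, ip u v = ip v u.
Hypothesis ip_linear : forall w, scalar (ip^~ w).
Hypothesis ip_gt0 : forall u, u != 0 -> 0 < ip u u.

Definition selfadjoint (f : U -> U) := forall u v, ip (f u) v = ip u (f v).

Lemma ip0l w : ip 0 w = 0.
Proof. by have := ip_linear w (-1) 0 0; rewrite scaler0 addr0 mulN1r addNr. Qed.

Lemma ipDl u v w : ip (u + v) w = ip u w + ip v w.
Proof. by rewrite -{1}[u]scale1r ip_linear mul1r. Qed.

Lemma ipZl a u w : ip (a *: u) w = a * ip u w.
Proof. by rewrite -[a *: u]addr0 ip_linear ip0l addr0. Qed.

Lemma ipDr u v w : ip w (u + v) = ip w u + ip w v.
Proof. by rewrite ipC ipDl !(ipC w). Qed.

Lemma ipZr a u w : ip w (a *: u) = a * ip w u.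
Proof. by rewrite ipC ipZl (ipC w). Qed.

Lemma ip0r w : ip w 0 = 0.
Proof. by rewrite ipC ip0l. Qed.

Lemma ip_ge0 u : 0 <= ip u u.
Proof. by have [->|/ip_gt0/ltW//] := eqVneq u 0; rewrite ip0l. Qed.

Lemma ip_eq0 u : (ip u u == 0) = (u == 0).
Proof.
by apply/idP/eqP => [|->]; [apply: contraTeq => /ip_gt0/lt0r_neq0 | rewrite ip0l].
Qed.

Section Operator.
Variable f : {linear U -> U}.
Hypothesis fS : selfadjoint f.

(* If [x + i y] is a complex eigenvector with eigenvalue [a + i b], then
   self-adjointness gives [b (|x|^2 + |y|^2) = 0]. *)
Lemma eigenvector_exists (W : {vspace U}) :
  (forall u, u \in W -> f u \in W) -> W != 0%VS ->
  exists a, exists2 v, v \in W & v != 0 /\ f v = a *: v.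
Proof.
move=> fW W0; have n0 : (0 < \dim W)%N by rewrite lt0n dimv_eq0.
set n := \dim W in n0.
pose e := vbasis W; have eP : basis_of W e := vbasisP W.
(* Coordinates are row vectors, so [f] acts on them by right multiplication by [M]. *)
pose M : 'M[R]_n := \matrix_(i, j) coord e j (f e`_i).
pose vec (x : 'rV[R]_n) := \sum_i x 0 i *: e`_i.
have eW (i : 'I_n) : e`_i \in W by apply: vbasis_mem; rewrite mem_nth ?size_tuple.
have vecW x : vec x \in W by apply: memv_suml => i _; apply: memvZ.
have vec0 x : vec x = 0 -> x = 0.
  have /freeP eF := basis_free eP => /eF x0.
  by apply/rowP => i; rewrite x0 mxE.
have fvec x : f (vec x) = vec (x *m M).
  rewrite linear_sum /vec; under [RHS]eq_bigr do rewrite mxE scaler_suml.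
  rewrite exchange_big; apply: eq_bigr => i _ /=.
  rewrite linearZ /= {1}(coord_basis eP (fW _ (eW i))) scaler_sumr.
  by apply: eq_bigr => j _; rewrite mxE scalerA.
have vecL a b x y : vec (a *: x + b *: y) = a *: vec x + b *: vec y.
  rewrite !scaler_sumr -big_split; apply: eq_bigr => i _.
  by rewrite !mxE scalerDl !scalerA.
have [z /eigenvalueP[w wM w0]] :=
  @eigenvalue_closed R[i] n (map_mx (real_complex R) M) n0.
pose x : 'rV[R]_n := map_mx (@complex.Re R) w.
pose y : 'rV[R]_n := map_mx (@complex.Im R) w.
have ReM (j : 'I_n) : (x *m M) 0 j = complex.Re ((w *m map_mx (real_complex R) M) 0 j).
  rewrite !mxE raddf_sum; apply: eq_bigr => i _; rewrite !mxE.
  by case: (w 0 i) => p q /=; rewrite mulr0 subr0.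
have ImM (j : 'I_n) : (y *m M) 0 j = complex.Im ((w *m map_mx (real_complex R) M) 0 j).
  rewrite !mxE raddf_sum; apply: eq_bigr => i _; rewrite !mxE.
  by case: (w 0 i) => p q /=; rewrite mulr0 add0r.
case: z wM => a b wM.
have xM : x *m M = a *: x + (- b) *: y.
  apply/rowP => j; rewrite ReM wM !mxE.
  by case: (w 0 j) => p q /=; rewrite mulNr.
have yM : y *m M = b *: x + a *: y.
  apply/rowP => j; rewrite ImM wM !mxE.
  by case: (w 0 j) => p q /=; rewrite addrC.
have xy0 : x != 0 \/ y != 0.
  have [x0|] := eqVneq x 0; last by left.
  right; apply: contraNneq w0 => y0; apply/eqP/rowP => j.
  move/rowP: x0 => /(_ j); move/rowP: y0 => /(_ j); rewrite !mxE.
  by case: (w 0 j) => p q /= -> ->.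
have fx : f (vec x) = a *: vec x + (- b) *: vec y by rewrite fvec xM vecL.
have fy : f (vec y) = b *: vec x + a *: vec y by rewrite fvec yM vecL.
have vec_neq0 u : u != 0 -> vec u != 0 by apply: contraNneq => /vec0 ->.
have b0 : b = 0.
  have := fS (vec x) (vec y).
  rewrite fx fy ipDl ipDr !ipZl !ipZr => H.
  have {H} : b * (ip (vec x) (vec x) + ip (vec y) (vec y)) = 0 by lra.
  move/eqP; rewrite mulf_eq0 => /orP[/eqP//|].
  rewrite paddr_eq0 ?ip_ge0// !ip_eq0 => /andP[].
  by case: xy0 => /vec_neq0/negbTE ->.
(* With [b = 0], each of [vec x] and [vec y] is zero or an eigenvector for [a], and they are not
   both zero. *)
move: fx fy; rewrite b0 oppr0 !scale0r addr0 add0r => fx fy.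
by exists a; case: xy0 => /vec_neq0 ?; [exists (vec x) | exists (vec y)].
Qed.

(** Orthogonal eigenpairs, not normalised. Freeness excludes zero vectors and repetitions, and makes
    the length of the list the dimension of its span. *)
Definition eigensystem (e : seq (R * U)) :=
  [/\ forall p, p \in e -> f p.2 = p.1 *: p.2,
      {in e &, forall p q, p != q -> ip p.2 q.2 = 0} & free (map snd e)].

(** Induction step for all later arguments on such lists: orthogonality to each later vector extends
    to their span. *)
Lemma eigensystem_cons p e : eigensystem (p :: e) ->
  [/\ f p.2 = p.1 *: p.2, p.2 != 0,
      forall u, u \in <<map snd e>>%VS -> ip p.2 u = 0 & eigensystem e].
Proof.
case=> eE eO /[dup] eF; rewrite /= free_cons => /andP[pe eF'].
have p0 : p.2 != 0 by apply: (free_not0 eF); rewrite mem_head.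
split=> //; first by rewrite eE ?mem_head.
  move=> u; rewrite -[map snd e]in_tupleE => /coord_span ->.
  elim/big_rec : _ => [|i v _ IH]; first exact: ip0r.
  rewrite ipDr ipZr IH addr0.
  have : (map snd e)`_i \in map snd e by apply: mem_nth.
  case/mapP => q qe ->; rewrite eO ?mulr0 ?mem_head//; first by rewrite inE qe orbT.
  by apply: contraNneq pe => ->; apply/memv_span/map_f.
by split=> // [q qe|q r qe re]; [apply: eE | apply: eO]; rewrite inE ?qe ?re orbT.
Qed.

Lemma eigensystem_perm e e' : perm_eq e e' -> eigensystem e -> eigensystem e'.
Proof.
move=> ee' [eE eO eF]; have me := perm_mem ee'.
split=> [p|p q|].
- by rewrite -me; apply: eE.
- by rewrite -!me; apply: eO.
by rewrite -(perm_free (perm_map snd ee')).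
Qed.

(** Used to pass from a sorted eigenbasis to its initial and final segments and to the part
    belonging to one eigenvalue. *)
Lemma eigensystem_subseq e e' : subseq e' e -> eigensystem e -> eigensystem e'.
Proof.
elim: e e' => [|p e IH] e'; first by rewrite subseq0 => /eqP ->.
case: e' => [|q e'] /=; first by move=> _ [? ? ?]; split=> //; apply: nil_free.
have consP r : subseq e' e -> r = p -> eigensystem (p :: e) -> eigensystem (r :: e').
  move=> s -> pe; have [pE p0 pO eS] := eigensystem_cons pe.
  have [? ? eF] := IH _ s eS; case: pe => eE eO.
  have sub x : x \in p :: e' -> x \in p :: e.
    by rewrite !inE => /orP[->//|/(mem_subseq s) ->]; rewrite orbT.
  rewrite /= !free_cons => /andP[pe _]; split=> [x /sub/eE//|x y /sub ? /sub ?|].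
    exact: eO.
  rewrite /= free_cons eF andbT; apply: contraNN pe; apply: subvP; apply: sub_span => x.
  by move/mapP => [y /(mem_subseq s) ye ->]; apply: map_f.
case: eqP => [qp s|_ s]; first exact: consP.
by move=> /eigensystem_cons[_ _ _]; apply: IH.
Qed.

Lemma eigensystem_stable e u : eigensystem e ->
  u \in <<map snd e>>%VS -> f u \in <<map snd e>>%VS.
Proof.
case=> eE _ _; rewrite -[map snd e]in_tupleE => /coord_span ->.
rewrite linear_sum; apply: memv_suml => i _ /=.
rewrite linearZ; apply: memvZ.
have : (map snd e)`_i \in map snd e by apply: mem_nth.
by case/mapP => q qe ->; rewrite eE// memvZ// memv_span// map_f.
Qed.

(* Covers both the upper ([t = 1]) and the lower ([t = -1]) Rayleigh bound. *)
Lemma eigensystem_rayleigh t a e u : eigensystem e ->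
  (forall p, p \in e -> 0 <= t * (a - p.1)) -> u \in <<map snd e>>%VS ->
  0 <= t * (a * ip u u - ip (f u) u).
Proof.
elim: e u => [|p e IH] u.
  by move=> _ _; rewrite span_nil memv0 => /eqP ->; rewrite ip0l ip0r mulr0 subr0 mulr0.
move=> /eigensystem_cons[pE p0 pO eS] ae /=.
rewrite span_cons => /memv_addP[_ /vlineP[c ->] [v ve ->]].
have pv := pO _ ve; have pfv := pO _ (eigensystem_stable eS ve).
rewrite linearD linearZ /= pE !(ipDl, ipDr, ipZl, ipZr) (ipC v) (ipC _ p.2) pv pfv.
have Hv : 0 <= t * (a * ip v v - ip (f v) v).
  by apply: IH => // q qe; apply: ae; rewrite inE qe orbT.
have Hp : 0 <= t * (a - p.1) * (c ^+ 2 * ip p.2 p.2).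
  by rewrite mulr_ge0 ?ae ?mem_head// mulr_ge0 ?sqr_ge0 ?ip_ge0.
lra.
Qed.

(** Pairing [f u = a *: u] with the head vector isolates its coefficient, which must vanish unless
    the head has eigenvalue [a]; the tail follows by induction. *)
Lemma eigensystem_eigenspace a e u : eigensystem e ->
  u \in <<map snd e>>%VS -> f u = a *: u ->
  u \in <<map snd [seq p <- e | p.1 == a]>>%VS.
Proof.
elim: e u => [//|p e IH] u.
move=> /eigensystem_cons[pE p0 pO eS] /=.
rewrite span_cons => /memv_addP[_ /vlineP[c ->] [v ve ->]].
have pv := pO _ ve; have pfv := pO _ (eigensystem_stable eS ve).
rewrite linearD linearZ /= pE => fu.
have : ip p.2 (c *: (p.1 *: p.2) + f v) = ip p.2 (a *: (c *: p.2 + v)) by rewrite fu.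
rewrite !(ipDr, ipZr) pv pfv => H.
have /eqP : (p.1 - a) * c * ip p.2 p.2 = 0 by lra.
rewrite mulf_eq0 ip_eq0 (negbTE p0) orbF mulf_eq0 subr_eq0 => pac.
have fv : f v = a *: v.
  move: fu; rewrite scalerDr !scalerA; case/orP: pac => /eqP ->.
    by rewrite [c * a]mulrC => /addrI.
  by rewrite mul0r mulr0 !scale0r !add0r.
have {IH} vE := IH v eS ve fv; case: eqP pac => [_ _|_ /= /eqP ->] /=.
  by rewrite span_cons memv_add ?memvZ ?memv_line.
by rewrite scale0r add0r.
Qed.

(** Induction on the dimension: an eigenvector [v] is split off, and self-adjointness keeps its
    orthogonal complement in [W] stable under [f]. *)
Lemma eigensystem_exists (W : {vspace U}) : (forall u, u \in W -> f u \in W) ->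
  exists2 e, eigensystem e & <<map snd e>>%VS = W.
Proof.
have [n] := ubnP (\dim W); elim: n W => // n IH W ltWn fW.
have [W0|W0] := eqVneq W 0%VS.
  by exists [::]; [split=> //; apply: nil_free | rewrite span_nil].
have [a [v vW [v0 fv]]] := eigenvector_exists fW W0.
(* The complement of [v] is built as the kernel of the linear form [ip^~ v]. *)
pose ipv : U -> R^o := ip^~ v.
pose Fl := GRing.isLinear.Build R U R^o _ ipv (ip_linear v).
pose FL : {linear U -> R^o} := HB.pack ipv Fl.
pose W' := (W :&: lker (linfun FL))%VS.
have W'E u : (u \in W') = (u \in W) && (ip u v == 0).
  by rewrite memv_cap memv_ker lfunE.
have vW' : v \notin W' by rewrite W'E ip_eq0 (negbTE v0) andbF.
have [||e eS eW'] := IH W'.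
- rewrite ltnS in ltWn; apply: leq_trans ltWn; rewrite ltn_neqAle dimvS ?capvSl// andbT.
  by apply: contraNneq vW' => dW; rewrite (eqP (_ : W' == W)) // eqEdim capvSl dW leqnn.
- by move=> u; rewrite !W'E => /andP[/fW -> /eqP uv]; rewrite fS fv ipZr uv mulr0 eqxx.
exists ((a, v) :: e); last first.
  apply/eqP; rewrite eqEsubv /= span_cons eW'; apply/andP; split.
    by rewrite subv_add -memvE vW capvSl.
  apply/subvP => u uW.
  (* Subtracting from [u] its orthogonal projection on [v] leaves a vector of [W']. *)
  rewrite -[u](subrK ((ip u v / ip v v) *: v)) addrC memv_add ?memvZ ?memv_line//.
  rewrite W'E memvB ?memvZ//= -scaleNr ipDl ipZl mulNr divfK ?subrr//.
  by rewrite ip_eq0.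
have eO p : p \in e -> ip p.2 v = 0.
  by move=> pe; have := memv_span (map_f snd pe); rewrite eW' W'E => /andP[_ /eqP].
case: eS => eE eO' eF; split=> [p|p q|].
- by rewrite inE => /orP[/eqP ->//|/eE].
- rewrite !inE => /orP[/eqP ->|pe] /orP[/eqP ->|qe]; rewrite ?eqxx//.
  + by rewrite ipC eO.
  + by rewrite eO.
  + exact: eO'.
- by rewrite /= free_cons eW' vW'.
Qed.

Lemma mem_leigenspace a u : (u \in leigenspace (linfun f) a) = (f u == a *: u).
Proof.
by rewrite memv_ker add_lfunE opp_lfunE scale_lfunE id_lfunE lfunE subr_eq0.
Qed.

(** An eigenbasis sorted by eigenvalue lists each [a] as often as the dimension of its eigenspace,
    since the basis vectors with eigenvalue [a] span that eigenspace. Uniqueness of the sorted list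
    then identifies it with [spectrum f]. *)
Lemma spectrum_eigensystem : exists e, [/\ eigensystem e,
  <<map snd e>>%VS = fullv & spectrum f = map fst e].
Proof.
have [|e0 e0S e0W] := @eigensystem_exists fullv; first by move=> *; rewrite memvf.
pose e := sort (relpre fst <=%R) e0.
have ee0 : perm_eq e0 e by rewrite perm_sym perm_sort.
have eS := eigensystem_perm ee0 e0S.
have eW : <<map snd e>>%VS = fullv.
  by rewrite -e0W; apply/eq_span => x; rewrite (perm_mem (perm_map snd ee0)).
exists e; split=> //; apply: is_spectrum_uniq (spectrumP f) _; split.
  by rewrite sorted_map; apply: sort_sorted => p q /=; apply: le_total.
move=> a; rewrite count_map -size_filter.
set s := filter _ _; have sS : eigensystem s := eigensystem_subseq (filter_subseq _ e) eS.
have [_ _ sF] := sS; rewrite -(size_map snd s) -(eqP sF) /mult.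
congr (\dim _); apply/eqP; rewrite eqEsubv; apply/andP; split.
  apply/span_subvP => _ /mapP[p ps ->]; rewrite mem_leigenspace.
  by case: sS => -> // _ _; move: ps; rewrite mem_filter => /andP[/eqP ->].
apply/subvP => u; rewrite mem_leigenspace => /eqP fu.
by apply: eigensystem_eigenspace => //; rewrite eW memvf.
Qed.

(** Ensures that [eigval f i] never reads the default [0] for [i] below the dimension. *)
Lemma size_spectrum : size (spectrum f) = \dim {:U}.
Proof.
have [e [[_ _ eF] eW ->]] := spectrum_eigensystem.
by rewrite -eW (eqP eF) !size_map.
Qed.

End Operator.

(** * Weyl-type comparison of eigenvalues *)

Section Comparison.
Variables f g : {linear U -> U}.
Hypotheses (fS : selfadjoint f) (gS : selfadjoint g).

Lemma spectrum_sorted (h : U -> U) : sorted <=%R (spectrum h).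
Proof. by have [] := spectrumP h. Qed.

(* The span of eigenvectors of [g] for its [i + 1] lowest eigenvalues meets the span
   of eigenvectors of [f] for all but its [i] lowest ones, by dimension count. *)
Lemma eigval_le c i : (forall u, ip (f u) u <= ip (g u) u + c * ip u u) ->
  (i < \dim {:U})%N -> eigval f i <= eigval g i + c.
Proof.
move=> fg iU.
have [e [eS eW fE]] := spectrum_eigensystem fS.
have [e' [eS' eW' gE]] := spectrum_eigensystem gS.
have sf := spectrum_sorted f; have sg := spectrum_sorted g.
have size_e : size e = \dim {:U} by rewrite -(size_spectrum fS) // fE size_map.
have size_e' : size e' = \dim {:U} by rewrite -(size_spectrum gS) // gE size_map.
have eSd := eigensystem_subseq (drop_subseq e i) eS.
have eSt := eigensystem_subseq (take_subseq e' i.+1) eS'.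
pose W := (<<map snd (drop i e)>> :&: <<map snd (take i.+1 e')>>)%VS.
have W0 : W != 0%VS.
  rewrite -dimv_eq0 -lt0n.
  (* The two spans have dimensions [n - i] and [i + 1], with sum [n + 1], where [n] is the dimension
     of [U]. *)
  have := dimv_sum_cap <<map snd (drop i e)>> <<map snd (take i.+1 e')>>.
  rewrite -/W; have [_ _ /eqP ->] := eSd; have [_ _ /eqP ->] := eSt.
  rewrite !size_map size_drop size_takel ?size_e'// size_e addnS.
  rewrite (subnK (ltnW iU)) => E.
  rewrite -(ltn_add2l (\dim (<<map snd (drop i e)>> + <<map snd (take i.+1 e')>>))).
  by rewrite addn0 E ltnS dimvS// subvf.
have /memv_capP := memv_pick W; set u := vpick W => -[ud ut].
have u0 : u != 0 by rewrite vpick0.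
(* On [u], [eigval f i] bounds the Rayleigh quotient of [f] from below, and [eigval g i] that of [g]
   from above. *)
have Hd : 0 <= -1 * (eigval f i * ip u u - ip (f u) u).
  apply: (eigensystem_rayleigh eSd) ud => p /(map_f fst).
  rewrite map_drop -fE => /(nthP 0)[j]; rewrite nth_drop size_drop ltn_subRL => ij <-.
  rewrite mulN1r oppr_ge0 subr_le0 /eigval.
  by apply: (sorted_leq_nth le_trans le_refl) => //; rewrite ?inE ?leq_addr//
    (leq_ltn_trans _ ij) ?leq_addr.
have Ht : 0 <= 1 * (eigval g i * ip u u - ip (g u) u).
  apply: (eigensystem_rayleigh eSt) ut => p /(map_f fst).
  rewrite map_take -gE => /(nthP 0)[j].
  rewrite size_takel ?size_spectrum// => ji; rewrite nth_take// => <-.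
  rewrite mul1r subr_ge0 /eigval.
  by apply: (sorted_leq_nth le_trans le_refl); rewrite // inE size_spectrum//
    (leq_ltn_trans _ iU).
rewrite -(ler_pM2r (ip_gt0 u0)); have := fg u; lra.
Qed.

End Comparison.

(** * Extreme eigenvalues and scalar operators *)

Section Bounds.
Variable f : {linear U -> U}.
Hypothesis fS : selfadjoint f.

Lemma spectrum_bounds a : a \in spectrum f -> eigval_min f <= a <= eigval_max f.
Proof.
move=> /(nthP 0)[j jf <-]; have s0 : (0 < size (spectrum f))%N by case: size jf.
rewrite /eigval_min /eigval_max -nth0 -nth_last (set_nth_default 0 _) ?prednK//.
have le := sorted_leq_nth le_trans le_refl 0 (spectrum_sorted f).
by rewrite !le ?inE ?prednK// -ltnS prednK.
Qed.

Lemma rayleigh_bounds u :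
  eigval_min f * ip u u <= ip (f u) u <= eigval_max f * ip u u.
Proof.
have [e [eS eW fE]] := spectrum_eigensystem fS.
have eB p : p \in e -> eigval_min f <= p.1 <= eigval_max f.
  by move=> pe; apply: spectrum_bounds; rewrite fE map_f.
have ue : u \in <<map snd e>>%VS by rewrite eW memvf.
have := @eigensystem_rayleigh _ 1 (eigval_max f) _ _ eS _ ue.
have := @eigensystem_rayleigh _ (-1) (eigval_min f) _ _ eS _ ue.
rewrite mul1r mulN1r oppr_ge0 subr_le0 subr_ge0 => -> => [->//|] p /eB /andP[].
  by rewrite mul1r subr_ge0.
by rewrite mulN1r oppr_ge0 subr_le0.
Qed.

(** Every vector of an eigenbasis then lies in one eigenspace, which is therefore the whole
    space. *)
Lemma eigval_min_eq_max : eigval_min f = eigval_max f ->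
  forall u, f u = eigval_min f *: u.
Proof.
move=> mM u; apply/eqP; rewrite -mem_leigenspace.
have [e [[eE _ _] eW fE]] := spectrum_eigensystem fS.
suff -> : leigenspace (linfun f) (eigval_min f) = fullv by rewrite memvf.
apply/eqP; rewrite eqEsubv subvf -eW; apply/span_subvP => _ /mapP[p pe ->].
rewrite mem_leigenspace eE//; have := @spectrum_bounds p.1.
by rewrite fE map_f// -mM => /(_ isT)/le_anti ->.
Qed.

(** Positive dimension makes the spectrum nonempty, so [head] and [last] return eigenvalues and not
    the default [0]. *)
Lemma eigval_scalar c : (0 < \dim {:U})%N -> (forall u, f u = c *: u) ->
  eigval_min f = c /\ eigval_max f = c.
Proof.
move=> U0 fc; have [_ cnt] := spectrumP f.
have all_c a : a \in spectrum f -> a = c.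
  rewrite -has_pred1 has_count cnt lt0n dimv_eq0 => /eqP.
  have [//|ac []] := eqVneq a c; apply/eqP; rewrite -subv0; apply/subvP => u.
  by rewrite mem_leigenspace fc memv0 -subr_eq0 -scalerBl scaler_eq0
    subr_eq0 eq_sym (negbTE ac).
rewrite /eigval_min /eigval_max; have := size_spectrum fS.
case: (spectrum f) all_c => [|a s] all_c /=; first by move=> U1; rewrite -U1 in U0.
by move=> _; split; apply: all_c; rewrite ?mem_head ?mem_last.
Qed.

End Bounds.
End InnerProduct.

(** * The weighted inner product and operators given by a kernel *)

Section WeightedProduct.
Variables (R : realType) (T : finType) (m : T -> R).
Hypothesis m_gt0 : forall x, 0 < m x.

Definition ipm (u v : {ffun T -> R^o}) : R := \sum_x m x * (u x * v x).

Lemma ipmC u v : ipm u v = ipm v u.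
Proof. by apply: eq_bigr => x _; rewrite (mulrC (u x)). Qed.

Lemma ipm_linear w : scalar (ipm^~ w).
Proof.
move=> a u v; rewrite /ipm mulr_sumr -big_split; apply: eq_bigr => x _ /=.
by rewrite !ffunE /GRing.scale /=; ring.
Qed.

Lemma ipm_gt0 u : u != 0 -> 0 < ipm u u.
Proof.
move=> u0; have t_ge0 x : 0 <= m x * (u x * u x) by rewrite mulr_ge0 ?(ltW (m_gt0 x)) ?sqr_ge0.
rewrite lt0r sumr_ge0 ?andbT// psumr_eq0//; apply: contraNN u0 => /allP u0.
apply/eqP/ffunP => x; have := u0 x (mem_index_enum x).
by rewrite /= !mulf_eq0 (gt_eqF (m_gt0 x)) orbb ffunE => /eqP.
Qed.

(** The weight [m x] cancels the factor [(m x)^-1], leaving the symmetric bilinear form of [K]. *)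
Lemma kernel_selfadjoint (K : T -> T -> R) (f : {ffun T -> R^o} -> {ffun T -> R^o}) :
  (forall x z, K x z = K z x) ->
  (forall u x, f u x = (m x)^-1 * \sum_z K x z * u z) -> selfadjoint ipm f.
Proof.
move=> KC fE u v.
have ipE w w' : ipm (f w) w' = \sum_x \sum_z K x z * w z * w' x.
  apply: eq_bigr => x _; rewrite fE -mulrA mulVKf ?lt0r_neq0 ?m_gt0//.
  by rewrite mulr_suml.
rewrite ipE ipmC ipE exchange_big; apply: eq_bigr => x _; apply: eq_bigr => z _.
by rewrite KC mulrAC.
Qed.

(** Supplies the linear structure under which the graph operators are bundled. *)
Lemma kernel_linear (K : T -> T -> R) (f : {ffun T -> R^o} -> {ffun T -> R^o}) :
  (forall u x, f u x = (m x)^-1 * \sum_z K x z * u z) -> linear f.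
Proof.
move=> fE a u v; apply/ffunP => x; rewrite !(ffunE, fE) /GRing.scale /=.
rewrite mulrCA -mulrDr; congr (_ * _); rewrite mulr_sumr -big_split.
by apply: eq_bigr => z _; rewrite !ffunE /GRing.scale /=; ring.
Qed.

End WeightedProduct.

(** * The graph operators and their kernels *)

Section GraphOperators.
Variables (R : realType) (V : finType) (G : wgraph R V).
Hypotheses (Gconn : connected G) (int_neq0 : ~: bd G != finset.set0).
Hypothesis EBB0 : no_bd_edge G.

Local Notation Om := (int_vertex G).
Local Notation Bd := (bd_vertex G).
Local Notation w := (wt G).
Local Notation m := (meas G).

Lemma wt_ge0 x y : 0 <= w x y.
Proof. by have [/wt_gt0/ltW//|/wt_eq0->] := boolP (edge G x y). Qed.

Lemma wt_neq0 x y : (w x y != 0) = edge G x y.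
Proof. by have [/wt_gt0/lt0r_neq0//|/wt_eq0->] := boolP (edge G x y); rewrite eqxx. Qed.

Lemma bd_wt0 x y : x \in bd G -> y \in bd G -> w x y = 0.
Proof. by move=> xB yB; rewrite wt_eq0// EBB0. Qed.

Lemma sum_sub (P : pred V) (F : V -> R) :
  \sum_(x | P x) F x = \sum_(x : {x | P x}) F (val x).
Proof.
rewrite (reindex_omap (val : {x | P x} -> V) insub) => [|x Px]; last by rewrite insubT.
by apply: eq_bigl => -[x Px]; rewrite Px /= insubT eqxx.
Qed.

Lemma sum_vertices (F : V -> R) :
  \sum_y F y = \sum_(y : Bd) F (val y) + \sum_(x : Om) F (val x).
Proof.
by rewrite (bigID (mem (bd G))) /= !sum_sub.
Qed.

Lemma Deg_sum (y : Bd) : m (val y) * Deg G (val y) = \sum_(x : Om) w (val y) (val x).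
Proof.
rewrite mulVKf ?gt_eqF ?meas_gt0// sum_vertices big1 ?add0r// => x _.
by rewrite bd_wt0 ?(valP x) ?(valP y).
Qed.

(** The first edge of a path from [y] to an interior vertex ends in the interior, as no two boundary
    vertices are joined. *)
Lemma bd_neighbor (y : Bd) : exists x : Om, edge G (val y) (val x).
Proof.
have /set0Pn[z] := int_neq0; rewrite inE => zB.
have /connectP[[|x p] /= pth zE] := Gconn (val y) z.
  by move: zB; rewrite zE (valP y).
have /andP[yx _] := pth.
have xB : x \notin bd G.
  by apply: contraL yx => xB; rewrite EBB0// (valP y).
by exists (exist _ x xB).
Qed.

Lemma Deg_gt0 (y : Bd) : 0 < m (val y) * Deg G (val y).
Proof.
rewrite Deg_sum; have [x yx] := bd_neighbor y.
rewrite (bigD1 x) //= ltr_pwDl ?wt_gt0// sumr_ge0 => // z _; exact: wt_ge0.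
Qed.

Lemma Deg_neq0 (y : Bd) : Deg G (val y) != 0.
Proof. by have := lt0r_neq0 (Deg_gt0 y); rewrite mulf_eq0 negb_or => /andP[]. Qed.

(** All neighbours of [y] are interior, where the extension equals [u], so the vanishing of the
    Laplacian at [y] can be solved for the value there. *)
Lemma extN_bd u (y : Bd) : extN G u (val y) = mul_invDeg G (adj_int G u) y.
Proof.
have [vu /(_ (val y) (valP y))] := extNP Gconn int_neq0 u.
move=> /eqP; set v := extN G u in vu *.
rewrite !ffunE mulf_eq0 invr_eq0 gt_eqF ?meas_gt0// orFb sum_vertices big1 => [|x _]; last first.
  by rewrite bd_wt0 ?(valP x) ?(valP y) // mulr0.
rewrite add0r; under eq_bigr do rewrite vu mulrBl.
rewrite sumrB -mulr_sumr -Deg_sum subr_eq0 => /eqP H.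
apply: (mulIf (lt0r_neq0 (Deg_gt0 y))); rewrite H.
by field; rewrite Deg_neq0 gt_eqF ?meas_gt0.
Qed.

Lemma ext0_int u (x : Om) : ext0 G u (val x) = u x.
Proof. by rewrite ffunE valK. Qed.

Lemma ext0_bd u (y : Bd) : ext0 G u (val y) = 0.
Proof. by rewrite ffunE insubF// (valP y). Qed.

Lemma LapD_eq u : LapD G u = LapN G u + adj_comp G u.
Proof.
have [vu _] := extNP Gconn int_neq0 u.
have restr_Lap v x : restr G (Lap G v) x =
  (m (val x))^-1 * \sum_y (v (val x) - v y) * w (val x) y by rewrite !ffunE.
apply/ffunP => x; rewrite [RHS]ffunE !restr_Lap [adj_comp G u x]ffunE -mulrDr.
congr (_ * _); rewrite !sum_vertices addrAC -big_split; congr (_ + _).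
  (* With [v] the Neumann extension, the boundary terms obey [u x = (u x - v y) + v y]. *)
  by apply: eq_bigr => y _; rewrite ext0_bd extN_bd ext0_int vu /= subr0 mulrBl subrK.
by apply: eq_bigr => y _; rewrite !ext0_int !vu.
Qed.

(** Matrix of [adj_comp] without the row factor [(m x)^-1], which makes it symmetric; it sums over
    two-step paths through the boundary. *)
Definition adj_kernel (x z : Om) : R :=
  \sum_(y : Bd) w (val x) (val y) * w (val z) (val y) / (m (val y) * Deg G (val y)).

Lemma adj_compE u x : adj_comp G u x = (m (val x))^-1 * \sum_z adj_kernel x z * u z.
Proof.
rewrite !ffunE; congr (_ * _); under [RHS]eq_bigr do rewrite mulr_suml.
rewrite exchange_big; apply: eq_bigr => y _ /=.
rewrite !ffunE mulr_sumr mulr_sumr mulr_suml; apply: eq_bigr => z _.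
rewrite (wt_sym G (val y) (val z)).
by field; rewrite Deg_neq0 gt_eqF ?meas_gt0.
Qed.

Lemma adj_kernelC x z : adj_kernel x z = adj_kernel z x.
Proof. by apply: eq_bigr => y _; rewrite (mulrC (w _ _)). Qed.

Definition LapD_kernel (x z : Om) : R :=
  (x == z)%:R * (\sum_y w (val x) y) - w (val x) (val z).

Lemma LapDE u x : LapD G u x = (m (val x))^-1 * \sum_z LapD_kernel x z * u z.
Proof.
rewrite !ffunE; congr (_ * _).
under eq_bigr do rewrite mulrBl; under [RHS]eq_bigr do rewrite mulrBl.
rewrite !sumrB; congr (_ - _).
  rewrite -mulr_sumr valK [RHS](bigD1 x)//= eqxx mul1r [X in _ + X]big1 ?addr0 1?mulrC// => z.
  by rewrite eq_sym => /negbTE ->; rewrite !mul0r.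
rewrite sum_vertices big1 => [|y _]; last by rewrite ext0_bd mul0r.
by rewrite add0r; apply: eq_bigr => z _; rewrite ext0_int mulrC.
Qed.

Lemma LapD_kernelC x z : LapD_kernel x z = LapD_kernel z x.
Proof.
by rewrite /LapD_kernel wt_sym eq_sym; case: eqP => [->//|_]; rewrite !mul0r.
Qed.

Local Notation ipO := (@ipm R Om (fun x => m (val x))).

Lemma meas_val_gt0 (x : Om) : 0 < m (val x). Proof. exact: meas_gt0. Qed.

Lemma LapD_selfadjoint : selfadjoint ipO (LapD G).
Proof. exact: (kernel_selfadjoint meas_val_gt0 LapD_kernelC LapDE). Qed.

Lemma adj_comp_selfadjoint : selfadjoint ipO (adj_comp G).
Proof. exact: (kernel_selfadjoint meas_val_gt0 adj_kernelC adj_compE). Qed.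

(** Read off from the difference of the other two operators, without unfolding the chosen extension
    [extN]. *)
Lemma LapN_kernelE u x : LapN G u x =
  (m (val x))^-1 * \sum_z (LapD_kernel x z - adj_kernel x z) * u z.
Proof.
have LE : (LapN G u + adj_comp G u) x = LapN G u x + adj_comp G u x by rewrite ffunE.
move: LE; rewrite -LapD_eq LapDE adj_compE => /(canLR (addrK _)) <-.
by under [in RHS]eq_bigr do rewrite mulrBl; rewrite sumrB mulrBr.
Qed.

Lemma LapN_selfadjoint : selfadjoint ipO (LapN G).
Proof.
have KC x z : LapD_kernel x z - adj_kernel x z = LapD_kernel z x - adj_kernel z x.
  by rewrite LapD_kernelC adj_kernelC.
exact: (kernel_selfadjoint meas_val_gt0 KC LapN_kernelE).
Qed.

(** * When the composite adjacency operator is scalar *)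

Lemma adj_kernel_ge0 (x z : Om) (y : Bd) :
  0 <= w (val x) (val y) * w (val z) (val y) / (m (val y) * Deg G (val y)).
Proof. by rewrite divr_ge0 ?(ltW (Deg_gt0 y))// mulr_ge0 ?wt_ge0. Qed.

(** A vanishing sum of nonnegative terms vanishes termwise, so no boundary vertex can join [x] to
    [z]. *)
Lemma adj_kernel_eq0 (x z : Om) (y : Bd) : adj_kernel x z = 0 ->
  edge G (val y) (val x) -> ~~ edge G (val y) (val z).
Proof.
move=> /eqP; rewrite psumr_eq0; last by move=> *; apply: adj_kernel_ge0.
move=> /allP /(_ y (mem_index_enum y)) /=; rewrite !mulf_eq0 invr_eq0 (gt_eqF (Deg_gt0 y)) orbF.
by rewrite ![w _ (val y)]wt_sym -!wt_neq0 => /orP[-> //|/negPn].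
Qed.

(** If [x] is the only interior neighbour of [y], the weighted degree sum at [y] is the single
    weight [w x y], and the term for [y] reduces to [w x y]. *)
Lemma adj_kernel_diag (x : Om) :
  (forall y : Bd, exists! x : Om, edge G (val y) (val x)) ->
  (m (val x))^-1 * adj_kernel x x = Deg_bd G x.
Proof.
move=> uniqx; congr (_ * _).
rewrite sum_sub; apply: eq_bigr => y _; rewrite Deg_sum.
have [wxy|wxy] := eqVneq (w (val x) (val y)) 0; first by rewrite wxy !mul0r.
have yx : edge G (val y) (val x) by rewrite -wt_neq0 wt_sym.
have [x' [yx' x'u]] := uniqx y.
rewrite (bigD1 x) //= big1 ?addr0 => [|z zx]; first by rewrite (wt_sym G (val y)) mulfK.
rewrite wt_eq0//; apply: contraNN zx => yz.
by rewrite -(x'u _ yx) (x'u _ yz).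
Qed.

Lemma adj_comp_scalarP :
  (exists c, forall u, adj_comp G u = c *: u) <->
  (forall y : Bd, exists! x : Om, edge G (val y) (val x)) /\
  (forall x x' : Om, Deg_bd G x = Deg_bd G x').
Proof.
split=> [[c cE]|[uniqx DegE]].
  (* Applying the operator to the indicator of [z] reads off its matrix entries. *)
  have KE (x z : Om) : (m (val x))^-1 * adj_kernel x z = c * (x == z)%:R.
    have /ffunP/(_ x) := cE [ffun t => (t == z)%:R : R^o].
    rewrite adj_compE (bigD1 z)//= big1 => [|t /negbTE tz]; rewrite !ffunE ?eqxx ?mulr1 ?addr0//.
    by rewrite tz mulr0.
  have uniqx (y : Bd) : exists! x : Om, edge G (val y) (val x).
    have [x yx] := bd_neighbor y; exists x; split=> // z; apply: contraTeq => xz.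
    apply: adj_kernel_eq0 yx; apply/eqP; move/eqP: (KE x z).
    by rewrite (negbTE xz) mulr0 mulf_eq0 invr_eq0 gt_eqF ?meas_gt0.
  split=> // x x'; rewrite -!adj_kernel_diag// !KE.
  by rewrite !eqxx.
have /set0Pn[x0] := int_neq0; rewrite inE => x0B.
exists (Deg_bd G (exist _ x0 x0B)) => u; apply/ffunP => x.
rewrite (DegE _ x) adj_compE (bigD1 x)//= big1 => [|z zx].
  by rewrite addr0 mulrA adj_kernel_diag// ffunE.
(* For [z] other than [x], a boundary vertex adjacent to [x] is not adjacent to [z], so every term
   has a zero factor. *)
rewrite [adj_kernel x z]big1 ?mul0r// => y _.
have [wxy|wxy] := eqVneq (w (val x) (val y)) 0; first by rewrite wxy !mul0r.
have yx : edge G (val y) (val x) by rewrite -wt_neq0 wt_sym.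
have [x' [_ x'u]] := uniqx y.
rewrite [w (val z) _]wt_sym [w _ (val z)]wt_eq0 ?mulr0 ?mul0r//.
by apply: contraNN zx => yz; rewrite -(x'u _ yx) (x'u _ yz).
Qed.

End GraphOperators.

(** * Eigenvalue bounds for the graph and their equality case *)

Theorem theorem1p7 (R : realType) (V : finType) (G : wgraph R V)
    (Gconn : connected G) (int_neq0 : ~: bd G != finset.set0)
    (EBB0 : no_bd_edge G) :
  (forall i : 'I_#|{: int_vertex G}|,
     eigval (LapN G) i + eigval_min (adj_comp G) <= eigval (LapD G) i
       <= eigval (LapN G) i + eigval_max (adj_comp G)) /\
  ((forall i : 'I_#|{: int_vertex G}|,
      eigval (LapN G) i + eigval_min (adj_comp G) = eigval (LapD G) i /\
      eigval (LapD G) i = eigval (LapN G) i + eigval_max (adj_comp G)) <->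
   (forall y : bd_vertex G, exists! x : int_vertex G, edge G (val y) (val x)) /\
   (forall x x' : int_vertex G, Deg_bd G x = Deg_bd G x')).
Proof.
pose U := {ffun int_vertex G -> R^o}.
pose ip := @ipm R (int_vertex G) (fun x => meas G (val x)).
have ip_gt0 : forall u, u != 0 -> 0 < ip u u by apply: ipm_gt0 => x; apply: meas_gt0.
have ipC : forall u v, ip u v = ip v u := @ipmC _ _ _.
have ipL : forall w, scalar (ip^~ w) := @ipm_linear _ _ _.
pose lin f (fl : linear f) : {linear U -> U} :=
  HB.pack f (GRing.isLinear.Build R U U _ f fl).
pose D := lin _ (kernel_linear (@LapDE _ _ G)).
pose N := lin _ (kernel_linear (LapN_kernelE Gconn int_neq0 EBB0)).
pose A := lin _ (kernel_linear (adj_compE Gconn int_neq0 EBB0)).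
have DS : selfadjoint ip D := @LapD_selfadjoint _ _ G.
have NS : selfadjoint ip N := LapN_selfadjoint Gconn int_neq0 EBB0.
have AS : selfadjoint ip A := adj_comp_selfadjoint Gconn int_neq0 EBB0.
have dimU : \dim {:U} = #|{: int_vertex G}| by rewrite dimvf /dim /= muln1.
have DE u : D u = N u + A u := LapD_eq Gconn int_neq0 EBB0 u.
have bounds (i : 'I_#|{: int_vertex G}|) :
    eigval N i + eigval_min A <= eigval D i <= eigval N i + eigval_max A.
  have iU : (i < \dim {:U})%N by rewrite dimU.
  have AB := rayleigh_bounds ipC ipL ip_gt0 AS.
  (* The lower bound becomes a comparison of [N] with [D] with constant [- eigval_min A]. *)
  rewrite -lerBrDr; apply/andP; split.
    apply: (eigval_le ipC ipL ip_gt0 NS DS) => // u.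
    rewrite DE (ipDl ipL); have /andP[+ _] := AB u; lra.
  apply: (eigval_le ipC ipL ip_gt0 DS NS) => // u.
  rewrite DE (ipDl ipL); have /andP[_ +] := AB u; lra.
split=> //; rewrite -adj_comp_scalarP//.
have card_gt0 : (0 < #|{: int_vertex G}|)%N.
  have /set0Pn[x] := int_neq0; rewrite inE => xB.
  by apply/card_gt0P; exists (exist _ x xB).
split=> [eqs|[c cE] i].
  exists (eigval_min A); apply: (eigval_min_eq_max ipC ipL ip_gt0 AS).
  (* The equalities at the lowest index alone already give [eigval_min A = eigval_max A]. *)
  have [e1 e2] := eqs (Ordinal card_gt0); exact: addrI (etrans e1 e2).
have [cm cM] : eigval_min (adj_comp G) = c /\ eigval_max (adj_comp G) = c.
  by apply: (eigval_scalar ipC ipL ip_gt0 AS) => //; rewrite dimU.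
by have := bounds i; rewrite /= cm cM => /le_anti ->.
Qed.
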